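(* Let $R$ be a commutative Noetherian ring with unity. The category of finitely generated graded $R[t]$-modules is isomorphic to the category of discrete algebraic persistence modules over $R$ of finitely generated type.
   Context: $\mathbb{N}=\{0,1,2,\dots\}$. $R[t]$ is graded over $\mathbb{N}$ with $R[t]_i$ the $R$-module generated by $t^i$. A graded $R[t]$-module is an $R[t]$-module $M$ with a decomposition $M=\bigoplus_{i\in\mathbb{N}}M_i$ into abelian groups such that $s\cdot m\in M_{i+j}$ for $s\in R[t]_i$, $m\in M_j$. A graded morphism $f:M\to N$ is an $R[t]$-module morphism with $f(M_i)\subseteq N_i$ for all $i$. A discrete algebraic persistence module (DAPM) over $R$ is a tuple $\mathcal{M}=((M_i)_{i\in\mathbb{N}},(\varphi_{i,j})_{i\le j\in\mathbb{N}})$ where each $M_i$ is an $R$-module, each $\varphi_{i,j}:M_i\to M_j$ is an $R$-module morphism, $\varphi_{i,i}=1_{M_i}$, and $\varphi_{i,k}=\varphi_{j,k}\circ\varphi_{i,j}$ for all $i\le j\le k$. A morphism of DAPMs from $((M_i),(\varphi_{i,j}))$ to $((N_i),(\psi_{i,j}))$ is a family $(\xi_i:M_i\to N_i)_{i\in\mathbb{N}}$ of $R$-module morphisms with $\psi_{i,j}\circ\xi_i=\xi_j\circ\varphi_{i,j}$ for all $i\le j$. A DAPM is of finite type if there is $D\in\mathbb{N}$ such that $\varphi_{i,j}$ is an isomorphism for all $D\le i\le j$. It is of finitely generated type if it is of finite type and every $M_i$ is finitely generated as an $R$-module. The two categories in the claim are the full subcategories, on the indicated objects, of the category of graded $R[t]$-modules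 with graded morphisms and of the category of DAPMs over $R$ with DAPM morphisms. Two categories are isomorphic if there are functors in both directions whose two compositions are the identity functors. *)

(* Defs.v *)
From HB Require Import structures.
From mathcomp Require Import all_boot all_order all_algebra.
From mathcomp Require Import boolp.
Set Implicit Arguments.
Unset Strict Implicit.
Unset Printing Implicit Defensive.
Import GRing.Theory.
Local Open Scope ring_scope.

Record category := Category {
  cat_ob :> Type;
  cat_hom : cat_ob -> cat_ob -> Type;
  cat_id : forall x, cat_hom x x;
  cat_comp : forall x y z, cat_hom y z -> cat_hom x y -> cat_hom x z;
  cat_idl : forall x y (f : cat_hom x y), cat_comp (cat_id y) f = f;
  cat_idr : forall x y (f : cat_hom x y), cat_comp f (cat_id x) = f;
  cat_assoc : forall x y z w (h : cat_hom z w) (g : cat_hom y z) (f : cat_hom x y),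
    cat_comp h (cat_comp g f) = cat_comp (cat_comp h g) f }.

Arguments cat_hom {c}.
Arguments cat_id {c}.
Arguments cat_comp {c x y z}.

Record functor (C D : category) := Functor {
  fob :> C -> D;
  fhom : forall x y : C, cat_hom x y -> cat_hom (fob x) (fob y);
  fhom_id : forall x : C, fhom (cat_id x) = cat_id (fob x);
  fhom_comp : forall (x y z : C) (g : cat_hom y z) (f : cat_hom x y),
    fhom (cat_comp g f) = cat_comp (fhom g) (fhom f) }.

Arguments fhom {C D} _ {x y}.

Definition id_functor (C : category) : functor C C :=
  @Functor C C (fun x => x) (fun x y f => f)
    (fun x => erefl) (fun x y z g f => erefl).

Definition comp_functor (C D E : category) (G : functor D E) (F : functor C D) :
  functor C E.
Proof.
refine (@Functor C E (fun x => G (F x)) (fun x y f => fhom G (fhom F f)) _ _).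
- by move=> x; rewrite !fhom_id.
- by move=> x y z g f; rewrite !fhom_comp.
Defined.

(* Strict isomorphism: the two composites are equal, as functors, to the
   identity functors (not just naturally isomorphic to them). *)
Definition isomorphic_categories (C D : category) : Prop :=
  exists (F : functor C D) (G : functor D C),
    comp_functor G F = id_functor C /\ comp_functor F G = id_functor D.

Definition full_subcategory (C : category) (P : C -> Prop) : category :=
  @Category {x : C | P x} (fun x y => cat_hom (sval x) (sval y))
    (fun x => cat_id (sval x)) (fun x y z g f => cat_comp g f)
    (fun x y f => cat_idl f) (fun x y f => cat_idr f)
    (fun x y z w h g f => cat_assoc h g f).

Definition is_ideal (R : comNzRingType) (I : R -> Prop) : Prop :=
  [/\ I 0, (forall x y, I x -> I y -> I (x + y)) &
      forall a x, I x -> I (a * x)].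

Definition noetherian (R : comNzRingType) : Prop :=
  forall I : R -> Prop, is_ideal I ->
    exists s : seq R, forall x,
      I x <-> exists a : nat -> R, x = \sum_(i < size s) a i * s`_i.

Definition finitely_generated (R : pzRingType) (M : lmodType R) : Prop :=
  exists s : seq M, forall x : M,
    exists a : nat -> R, x = \sum_(i < size s) a i *: s`_i.

Lemma linear_ext (R : pzRingType) (U V : lmodType R) (f g : {linear U -> V}) :
  f =1 g -> f = g.
Proof.
case: f g => [f [[f1] [f2]]] [g [[g1] [g2]]] /= /funext fg.
move: f1 f2 g1 g2; rewrite fg => f1 f2 g1 g2.
by rewrite (Prop_irrelevance f1 g1) (Prop_irrelevance f2 g2).
Qed.

Section DirectSum.
Variable V : nat -> zmodType.

(* Over the index set nat, finite support means vanishing from some index on. *)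
Record dirsum := Dirsum {
  coord :> forall i, V i;
  coord_fin : exists n : nat, forall i, (n <= i)%N -> coord i = 0 }.

Lemma dirsumP (x y : dirsum) : (forall i, x i = y i) -> x = y.
Proof.
case: x y => [x xf] [y yf] /= xy.
have {}xy : x = y by apply: functional_extensionality_dep.
by case: _ / xy yf => yf; rewrite (Prop_irrelevance xf yf).
Qed.

HB.instance Definition _ := gen_eqMixin dirsum.
HB.instance Definition _ := gen_choiceMixin dirsum.

Definition dirsum0 : dirsum.
Proof. by exists (fun i => 0); exists 0%N. Defined.

Definition dirsum_opp (x : dirsum) : dirsum.
Proof.
exists (fun i => - x i).
by case: (coord_fin x) => n xn; exists n => i /xn ->; rewrite oppr0.
Defined.

Definition dirsum_add (x y : dirsum) : dirsum.
Proof.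
exists (fun i => x i + y i).
case: (coord_fin x) (coord_fin y) => n xn [m ym]; exists (maxn n m) => i.
by rewrite geq_max => /andP[/xn -> /ym ->]; rewrite addr0.
Defined.

Lemma dirsum_addA : associative dirsum_add.
Proof. by move=> x y z; apply: dirsumP => i /=; rewrite addrA. Qed.

Lemma dirsum_addC : commutative dirsum_add.
Proof. by move=> x y; apply: dirsumP => i /=; rewrite addrC. Qed.

Lemma dirsum_add0 : left_id dirsum0 dirsum_add.
Proof. by move=> x; apply: dirsumP => i /=; rewrite add0r. Qed.

Lemma dirsum_addN : left_inverse dirsum0 dirsum_opp dirsum_add.
Proof. by move=> x; apply: dirsumP => i /=; rewrite addNr. Qed.

HB.instance Definition _ := GRing.isZmodule.Build dirsum
  dirsum_addA dirsum_addC dirsum_add0 dirsum_addN.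

(* Membership in the i-th summand V i of the direct sum. *)
Definition in_summand (i : nat) (x : dirsum) : Prop :=
  forall j, j <> i -> x j = 0.

End DirectSum.

Section GradedModules.
Variable R : comNzRingType.

Definition poly_summand (i : nat) (s : {poly R}) : Prop :=
  exists a : R, s = a *: 'X^i.

(* A graded R[t]-module: a sequence of abelian groups and an R[t]-module
   structure, compatible with the gradings, on their external direct sum. With
   subgroups of an ambient module instead, the i-th component of a direct sum
   of modules N j would only be isomorphic to N i, not equal to it. *)
Record gmodule := GModule {
  gm_comp : nat -> zmodType;
  gm_scale : {poly R} -> dirsum gm_comp -> dirsum gm_comp;
  gm_scaleA : forall a b m, gm_scale a (gm_scale b m) = gm_scale (a * b) m;
  gm_scale1 : left_id 1 gm_scale;
  gm_scaleDr : right_distributive gm_scale +%R;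
  gm_scaleDl : forall m, {morph gm_scale^~ m : a b / a + b};
  gm_graded : forall i j (s : {poly R}) (m : dirsum gm_comp),
    poly_summand i s -> in_summand j m -> in_summand (i + j) (gm_scale s m) }.

Definition gm_sum (M : gmodule) : Type := dirsum (gm_comp M).
HB.instance Definition _ (M : gmodule) := GRing.Zmodule.on (gm_sum M).
HB.instance Definition _ (M : gmodule) :=
  GRing.Zmodule_isLmodule.Build {poly R} (gm_sum M)
    (@gm_scaleA M) (@gm_scale1 M) (@gm_scaleDr M) (@gm_scaleDl M).

Record ghom (M N : gmodule) := GHom {
  gh_fun :> {linear gm_sum M -> gm_sum N};
  gh_graded : forall i (x : gm_sum M), in_summand i x -> in_summand i (gh_fun x) }.

Lemma ghomP (M N : gmodule) (f g : ghom M N) : f =1 g -> f = g.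
Proof.
case: f g => [f fg] [g gg] /= /linear_ext E.
by case: _ / E gg => gg; rewrite (Prop_irrelevance fg gg).
Qed.

Definition ghom_id (M : gmodule) : ghom M M :=
  @GHom M M (idfun : {linear gm_sum M -> gm_sum M}) (fun i x h => h).

Definition ghom_comp (M N P : gmodule) (g : ghom N P) (f : ghom M N) : ghom M P :=
  @GHom M P (g \o f : {linear gm_sum M -> gm_sum P})
    (fun i x h => gh_graded g (gh_graded f h)).

Definition gmodule_category : category.
Proof.
refine (@Category gmodule ghom ghom_id ghom_comp _ _ _).
- by move=> M N f; apply: ghomP.
- by move=> M N f; apply: ghomP.
- by move=> M N P Q h g f; apply: ghomP.
Defined.

Definition fg_gmodule_category : category :=
  @full_subcategory gmodule_category
    (fun M : gmodule => finitely_generated (gm_sum M)).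

End GradedModules.

Section PersistenceModules.
Variable R : comNzRingType.

Record dapm := DAPM {
  pm_comp :> nat -> lmodType R;
  pm_map : forall i j, (i <= j)%N -> {linear pm_comp i -> pm_comp j};
  pm_map_id : forall i (ii : (i <= i)%N) x, pm_map ii x = x;
  pm_map_comp : forall i j k (ij : (i <= j)%N) (jk : (j <= k)%N) (ik : (i <= k)%N) x,
    pm_map ik x = pm_map jk (pm_map ij x) }.

Record dapm_hom (M N : dapm) := DAPMHom {
  ph_fun :> forall i, {linear M i -> N i};
  ph_comm : forall i j (ij : (i <= j)%N) x,
    pm_map N ij (ph_fun i x) = ph_fun j (pm_map M ij x) }.

Lemma dapm_homP (M N : dapm) (f g : dapm_hom M N) : (forall i, f i =1 g i) -> f = g.
Proof.
case: f g => [f fc] [g gc] /= E.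
have {}E : f = g.
  by apply: functional_extensionality_dep => i; exact: linear_ext (E i).
by case: _ / E gc => gc; rewrite (Prop_irrelevance fc gc).
Qed.

Definition dapm_id (M : dapm) : dapm_hom M M :=
  @DAPMHom M M (fun i => idfun : {linear M i -> M i}) (fun i j ij x => erefl).

Definition dapm_comp (M N P : dapm) (g : dapm_hom N P) (f : dapm_hom M N) :
  dapm_hom M P.
Proof.
refine (@DAPMHom M P (fun i => g i \o f i : {linear M i -> P i}) _).
by move=> i j ij x /=; rewrite !ph_comm.
Defined.

Definition dapm_category : category.
Proof.
refine (@Category dapm dapm_hom dapm_id dapm_comp _ _ _).
- by move=> M N f; apply: dapm_homP.
- by move=> M N f; apply: dapm_homP.
- by move=> M N P Q h g f; apply: dapm_homP.
Defined.

Definition linear_iso (U V : lmodType R) (f : {linear U -> V}) : Prop :=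
  exists g : {linear V -> U}, cancel f g /\ cancel g f.

Definition finite_type (M : dapm) : Prop :=
  exists D : nat, forall i j (ij : (i <= j)%N), (D <= i)%N ->
    linear_iso (pm_map M ij).

Definition fg_type (M : dapm) : Prop :=
  finite_type M /\ forall i, finitely_generated (M i).

Definition fg_dapm_category : category :=
  @full_subcategory dapm_category fg_type.

End PersistenceModules.

(* Main.v *)
Require Import Defs.
From HB Require Import structures.
From mathcomp Require Import all_boot all_order all_algebra.
From mathcomp Require Import boolp.
Set Implicit Arguments.
Unset Strict Implicit.
Unset Printing Implicit Defensive.
Import GRing.Theory.
Local Open Scope ring_scope.

(** A graded R[t]-module is the same data as a persistence module: multiplication
by t restricts to R-linear maps between consecutive components, and conversely
a sequence of such maps tells how t acts on the direct sum. Explicitly, the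
transition map from degree i to degree j is multiplication by t^(j - i)
([gm_shift]), and a polynomial p acts on a family x by the convolution
(p x)_k = \sum_(i <= k) p_(k - i) phi_(i, k) (x_i) ([pm_scale]). Both passages
keep the underlying additive groups, so they are inverse to each other on the
nose ([gmodule_functorK], [dapm_functorK]).

It remains to match the two finiteness conditions, since the isomorphism then
restricts to full subcategories ([full_restriction_cancel]).

If a graded module is generated by finitely many elements, their homogeneous
parts, moved up by powers of t, generate every component over R
([component_gens_span]). Beyond a degree D that bounds the supports of the
generators nothing new appears, so the transition maps out of degree D are
onto. Those elements of degree D that die eventually form a submodule of a
finitely generated R-module; as R is Noetherian, this submodule is finitely
generated ([noetherian_submodule]), so all of it is dead at some later degree E
([finite_type_of_surjective]). From E on the transition maps are therefore also
injective.

Conversely, if the transition maps are isomorphisms from degree D on, every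
homogeneous element of degree above D is a power of t times one of degree D, so
generators of the components of degree at most D generate the whole module
([fg_gmodule_of_dapm]). *)

(* Keeps simplification from unfolding coordinates down to the raw function. *)
Local Arguments Defs.coord : simpl never.

(** * Strict equality of functors *)

Section EqualityOfFunctors.

(** With such morphisms, equality of functors is checked as commutativity of
squares, without casts in hom types. *)
Definition eq_hom (C : category) (x y : C) (e : x = y) : cat_hom x y :=
  ecast y (cat_hom x y) e (cat_id x).

(** Once the object parts are identified, the comparison morphisms become
identities by proof irrelevance, and the squares say that the morphism parts
agree. *)
Lemma functor_eq (C D : category) (F G : functor C D) (e : forall x, F x = G x) :
  (forall (x y : C) (f : cat_hom x y),
     cat_comp (eq_hom (e y)) (fhom F f) = cat_comp (fhom G f) (eq_hom (e x))) ->
  F = G.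
Proof.
case: F G e => [F Ff Fi Fc] [G Gf Gi Gc] /= e.
have FG : F = G by apply: funext.
case: G / FG Gf Gi Gc e => Gf Gi Gc e natF.
have FGf : Ff = Gf.
  apply: functional_extensionality_dep => x.
  apply: functional_extensionality_dep => y.
  apply: functional_extensionality_dep => f.
  have:= natF _ _ f.
  by rewrite (Prop_irrelevance (e y) erefl) (Prop_irrelevance (e x) erefl)
    /= cat_idl cat_idr.
case: Gf / FGf Gi Gc {e natF} => Gi Gc.
by rewrite (Prop_irrelevance Fi Gi) (Prop_irrelevance Fc Gc).
Qed.

Lemma eq_functor_natural (C D : category) (F G : functor C D) (FG : F = G)
    (e : forall x, F x = G x) (x y : C) (f : cat_hom x y) :
  cat_comp (eq_hom (e y)) (fhom F f) = cat_comp (fhom G f) (eq_hom (e x)).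
Proof.
case: G / FG e => e.
by rewrite (Prop_irrelevance (e y) erefl) (Prop_irrelevance (e x) erefl)
  /= cat_idl cat_idr.
Qed.

Lemma eq_hom_full (C : category) (P : C -> Prop) (x y : full_subcategory P)
  (e : x = y) : eq_hom e = eq_hom (congr1 sval e) :> cat_hom (sval x) (sval y).
Proof. by case: y / e. Qed.

Definition full_restriction (C D : category) (P : C -> Prop) (Q : D -> Prop)
    (F : functor C D) (PQ : forall x, P x -> Q (F x)) :
  functor (full_subcategory P) (full_subcategory Q) :=
  @Functor (full_subcategory P) (full_subcategory Q)
    (fun x => exist Q (F (sval x)) (PQ _ (svalP x))) (fun x y f => fhom F f)
    (fun x => fhom_id F (sval x)) (fun x y z g f => fhom_comp F g f).

(** Morphisms of a full subcategory ignore the membership proofs, and these proofs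
are irrelevant for equality of objects, so a strict inverse restricts. *)
Lemma full_restriction_cancel (C D : category) (P : C -> Prop) (Q : D -> Prop)
    (F : functor C D) (G : functor D C) (PQ : forall x, P x -> Q (F x))
    (QP : forall y, Q y -> P (G y)) :
  comp_functor G F = id_functor C ->
  comp_functor (full_restriction QP) (full_restriction PQ) =
    id_functor (full_subcategory P).
Proof.
move=> GF; have e x : G (F x) = x := congr1 (fun H : functor C C => H x) GF.
have e' (x : full_subcategory P) :
    comp_functor (full_restriction QP) (full_restriction PQ) x = x.
  by case: x => x Px; apply: eq_exist; exact: e.
apply: (@functor_eq _ _ _ (id_functor _) e') => x y f; rewrite !eq_hom_full.
rewrite (Prop_irrelevance (congr1 _ (e' x)) (e (sval x))).
rewrite (Prop_irrelevance (congr1 _ (e' y)) (e (sval y))).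
exact: (eq_functor_natural GF e f).
Qed.

End EqualityOfFunctors.

(** * Homogeneous elements of a direct sum *)

Section Summands.
Variable V : nat -> zmodType.

Definition single (i : nat) (v : V i) : dirsum V.
Proof.
exists (dfwith (fun j => 0 : V j) v); exists i.+1 => j ij.
by rewrite dfwith_out // neq_ltn ij.
Defined.

Lemma single_in i (v : V i) : single v i = v.
Proof. exact: dfwith_in. Qed.

Lemma single_out i j (v : V i) : j <> i -> single v j = 0.
Proof. by move=> ji; apply: dfwith_out; apply/eqP => /esym. Qed.

Lemma in_summand_single i (v : V i) : in_summand i (single v).
Proof. by move=> j; exact: single_out. Qed.

Lemma in_summandE i (x : dirsum V) : in_summand i x -> x = single (x i).
Proof.
move=> xi; apply: dirsumP => j; have [->|/eqP ji] := eqVneq j i.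
  by rewrite single_in.
by rewrite single_out // xi.
Qed.

Lemma singleD i : {morph @single i : v w / v + w}.
Proof.
move=> v w; apply: dirsumP => j.
rewrite -[RHS]/(single v j + single w j); have [->|/eqP ji] := eqVneq j i.
  by rewrite !single_in.
by rewrite !single_out // addr0.
Qed.

Lemma single0 i : single (0 : V i) = 0.
Proof. by apply: (addrI (single (0 : V i))); rewrite -singleD !addr0. Qed.

Lemma coord_sum (I : Type) (r : seq I) (P : pred I) (x : I -> dirsum V) j :
  (\sum_(i <- r | P i) x i) j = \sum_(i <- r | P i) x i j.
Proof. by apply: (big_morph (fun x : dirsum V => x j)). Qed.

(** A family with finite support is the sum of its homogeneous parts, so additive
statements need to be checked on homogeneous elements only. *)
Lemma dirsum_ind (P : dirsum V -> Prop) : P 0 ->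
  (forall x y, P x -> P y -> P (x + y)) -> (forall i (v : V i), P (single v)) ->
  forall x, P x.
Proof.
move=> P0 PD Psingle x; have [n xn] := coord_fin x.
have -> : x = \sum_(i < n) single (x i).
  apply: dirsumP => j; rewrite coord_sum; case: (ltnP j n) => jn.
    rewrite (bigD1 (Ordinal jn)) //= single_in big1 ?addr0 // => i ij.
    by apply: single_out => ji; case/eqP: ij; apply: val_inj.
  rewrite xn // big1 // => i _; apply: single_out => ji.
  by rewrite ji leqNgt ltn_ord in jn.
by apply: big_ind.
Qed.

End Summands.

(** * From graded modules to persistence modules *)

Local Notation gsingle M v := (@single (gm_comp M) _ v : gm_sum M).

Section PersistenceOfGraded.
Variables (R : comNzRingType) (M : gmodule R).
Implicit Types (p : {poly R}) (i j : nat).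

Lemma in_summand_monomial a k i (v : gm_comp M i) :
  in_summand (k + i) ((a *: 'X^k : {poly R}) *: gsingle M v).
Proof. by apply: gm_graded; [exists a | exact: in_summand_single]. Qed.

(** Only the monomial of degree j - i in p can carry degree i to degree j. *)
Lemma coord_scale_eq0 p i j (v : gm_comp M i) :
  (forall k, (k + i)%N = j -> p`_k = 0) -> (p *: gsingle M v) j = 0.
Proof.
move=> p0; rewrite -(coefK p) poly_def scaler_suml coord_sum big1 // => k _.
have [/eqP/p0 ->|/eqP kij] := boolP (k + i == j)%N.
  by rewrite scale0r scale0r.
by apply: in_summand_monomial => /esym.
Qed.

Lemma coord_scale p i j (v : gm_comp M i) : (i <= j)%N ->
  (p *: gsingle M v) j =
  ((p`_(j - i) *: 'X^(j - i) : {poly R}) *: gsingle M v) j.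
Proof.
move=> ij; set q := _ *: _ : {poly R}; rewrite -[p in LHS](subrK q) scalerDl.
rewrite -[LHS]/(((p - q) *: gsingle M v) j + _) coord_scale_eq0 ?add0r //.
move=> k kij; have -> : k = (j - i)%N by rewrite -kij addnK.
by rewrite coefB coefZ coefXn eqxx mulr1 subrr.
Qed.

(** A fresh name for the additive group of degree i, to which the R-module structure
coming from constant polynomials is attached. *)
Definition gm_lcomp i : Type := gm_comp M i.
HB.instance Definition _ i := GRing.Zmodule.on (gm_lcomp i).

Definition gm_lscale i (a : R) (v : gm_lcomp i) : gm_lcomp i :=
  (a%:P *: gsingle M v) i.

(** Constants have degree 0, so they keep a homogeneous element in its degree. With
this and [single_shift], the module axioms and the functoriality of the shifts
reduce to associativity of the R[t]-action. *)
Lemma single_lscale i a (v : gm_lcomp i) :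
  gsingle M (gm_lscale a v) = a%:P *: gsingle M v.
Proof.
rewrite /gm_lscale -in_summandE //.
have -> : a%:P = a *: 'X^0 by rewrite expr0 alg_polyC.
exact: (in_summand_monomial a (k := 0)).
Qed.

Lemma gm_lscaleA i a b (v : gm_lcomp i) :
  gm_lscale a (gm_lscale b v) = gm_lscale (a * b) v.
Proof. by rewrite {1}/gm_lscale single_lscale scalerA -polyCM. Qed.

Lemma gm_lscale1 i : left_id 1 (@gm_lscale i).
Proof. by move=> v; rewrite /gm_lscale scale1r single_in. Qed.

Lemma gm_lscaleDr i : right_distributive (@gm_lscale i) +%R.
Proof. by move=> a v w; rewrite /gm_lscale singleD scalerDr. Qed.

Lemma gm_lscaleDl i (v : gm_lcomp i) : {morph (@gm_lscale i)^~ v : a b / a + b}.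
Proof. by move=> a b; rewrite /gm_lscale polyCD scalerDl. Qed.

HB.instance Definition _ i := GRing.Zmodule_isLmodule.Build R (gm_lcomp i)
  (@gm_lscaleA i) (@gm_lscale1 i) (@gm_lscaleDr i) (@gm_lscaleDl i).

Definition gm_shift i j (ij : (i <= j)%N) (v : gm_lcomp i) : gm_lcomp j :=
  ('X^(j - i) *: gsingle M v) j.

Lemma single_shift i j (ij : (i <= j)%N) (v : gm_lcomp i) :
  gsingle M (gm_shift ij v) = 'X^(j - i) *: gsingle M v.
Proof.
rewrite -in_summandE // -['X^_]scale1r -{1}(subnK ij).
exact: in_summand_monomial.
Qed.

Lemma gm_shift_is_linear i j (ij : (i <= j)%N) : linear (gm_shift ij).
Proof.
move=> a v w; rewrite -[a *: v]/(gm_lscale a v) -[a *: _]/(gm_lscale a _).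
rewrite {1}/gm_shift singleD scalerDr single_lscale.
by rewrite {1}/gm_lscale single_shift scalerA mulrC -scalerA.
Qed.

HB.instance Definition _ i j (ij : (i <= j)%N) :=
  GRing.isLinear.Build R (gm_lcomp i) (gm_lcomp j) *:%R (gm_shift ij)
    (gm_shift_is_linear ij).

Lemma gm_shift_id i (ii : (i <= i)%N) (v : gm_lcomp i) : gm_shift ii v = v.
Proof. by rewrite /gm_shift subnn scale1r single_in. Qed.

Lemma gm_shift_comp i j k (ij : (i <= j)%N) (jk : (j <= k)%N) (ik : (i <= k)%N)
  (v : gm_lcomp i) : gm_shift ik v = gm_shift jk (gm_shift ij v).
Proof.
rewrite {2}/gm_shift single_shift scalerA -exprD /gm_shift.
by rewrite addnBA // subnK.
Qed.

Definition dapm_of_gmodule : dapm R :=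
  @DAPM R gm_lcomp (fun i j ij => gm_shift ij : {linear gm_lcomp i -> gm_lcomp j})
    gm_shift_id gm_shift_comp.

End PersistenceOfGraded.

Section PersistenceOfGradedHom.
Variables (R : comNzRingType) (M N : gmodule R) (f : ghom M N).

Definition gh_comp i (v : gm_lcomp M i) : gm_lcomp N i :=
  f (gsingle M v) i.

Lemma single_gh_comp i (v : gm_lcomp M i) :
  gsingle N (gh_comp v) = f (gsingle M v).
Proof. by rewrite -in_summandE //; apply/gh_graded/in_summand_single. Qed.

Lemma gh_comp_is_linear i : linear (@gh_comp i).
Proof.
move=> a v w; rewrite -[a *: v]/(gm_lscale a v) -[a *: _]/(gm_lscale a _).
rewrite {1}/gh_comp singleD linearD single_lscale linearZ.
by rewrite {1}/gm_lscale single_gh_comp.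
Qed.

HB.instance Definition _ i :=
  GRing.isLinear.Build R (gm_lcomp M i) (gm_lcomp N i) *:%R (@gh_comp i)
    (@gh_comp_is_linear i).

Definition dapm_hom_of_ghom :
  dapm_hom (dapm_of_gmodule M) (dapm_of_gmodule N).
Proof.
refine (@DAPMHom R (dapm_of_gmodule M) (dapm_of_gmodule N)
  (fun i => @gh_comp i : {linear gm_lcomp M i -> gm_lcomp N i}) _).
move=> i j ij v /=.
by rewrite /gm_shift single_gh_comp -linearZ /gh_comp single_shift.
Defined.

End PersistenceOfGradedHom.

Definition dapm_functor (R : comNzRingType) :
  functor (gmodule_category R) (dapm_category R).
Proof.
refine (@Functor (gmodule_category R) (dapm_category R)
  (@dapm_of_gmodule R) (@dapm_hom_of_ghom R) _ _).
- by move=> M; apply: dapm_homP => i v; exact: (@single_in (gm_comp M) i v).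
- move=> M N P g f; apply: dapm_homP => i v /=.
  by rewrite /gh_comp single_gh_comp.
Defined.

(** * From persistence modules to graded modules *)

Section GradedOfPersistence.
Variables (R : comNzRingType) (M : dapm R).
Implicit Types (p q : {poly R}) (i j k : nat).

(** Extending the transition maps by 0 in decreasing degrees removes the order
proofs from the summation index in the formula for the R[t]-action. *)
Definition pm_ext i j (v : M i) : M j :=
  if pselect (i <= j)%N is left ij then pm_map M ij v else 0.

Lemma pm_extE i j (ij : (i <= j)%N) (v : M i) : pm_ext j v = pm_map M ij v.
Proof.
rewrite /pm_ext; case: pselect => [ij'|//].
by rewrite (Prop_irrelevance ij' ij).
Qed.

Lemma pm_ext_gt i j (v : M i) : (j < i)%N -> pm_ext j v = 0.
Proof. by rewrite ltnNge /pm_ext; case: pselect => // ij; rewrite ij. Qed.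

Lemma pm_ext_is_linear i j : linear (@pm_ext i j).
Proof.
move=> a v w; case: (leqP i j) => ij; first by rewrite !pm_extE linearP.
by rewrite !pm_ext_gt // scaler0 addr0.
Qed.

HB.instance Definition _ i j :=
  GRing.isLinear.Build R (M i) (M j) *:%R (@pm_ext i j) (@pm_ext_is_linear i j).

(** Gives the direct sum a family of additive groups, not of R-modules, as index. *)
Definition pm_zcomp i : zmodType := M i.

Definition pm_scale p (x : dirsum pm_zcomp) : dirsum pm_zcomp.
Proof.
exists (fun k => \sum_(i < k.+1) p`_(k - i) *: pm_ext k (x i) : M k).
have [n xn] := coord_fin x; exists (size p + n)%N => k pnk.
rewrite big1 // => i _; have [ni|ni] := leqP n i.
  by rewrite xn // linear0 scaler0.
(* Here i < n while k >= size p + n, so k - i is beyond the size of p. *)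
rewrite nth_default ?scale0r // leq_subRL ?(leq_trans (ltnW ni)) //.
- by rewrite addnC (leq_trans _ pnk) // leq_add2l ltnW.
- by rewrite (leq_trans _ pnk) // leq_addl.
Defined.

Lemma pm_scaler0 p : pm_scale p 0 = 0.
Proof.
by apply: dirsumP => k; apply: big1 => i _; rewrite linear0 scaler0.
Qed.

Lemma pm_scaleDr : right_distributive pm_scale +%R.
Proof.
move=> p x y; apply: dirsumP => k.
rewrite -[RHS]/((pm_scale p x k + pm_scale p y k : M k)).
rewrite -big_split; apply: eq_bigr => i _ /=.
by rewrite -scalerDr -linearD.
Qed.

Lemma pm_scaleDl (x : dirsum pm_zcomp) : {morph pm_scale^~ x : p q / p + q}.
Proof.
move=> p q; apply: dirsumP => k.
rewrite -[RHS]/((pm_scale p x k + pm_scale q x k : M k)).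
rewrite -big_split; apply: eq_bigr => i _ /=.
by rewrite coefD scalerDl.
Qed.

Lemma pm_sum_single p i k (x : forall j, M j) :
    (forall j, j <> i -> x j = 0) ->
  \sum_(j < k.+1) p`_(k - j) *: pm_ext k (x j) = p`_(k - i) *: pm_ext k (x i).
Proof.
move=> xi; have [ik|ki] := leqP i k; last first.
  rewrite pm_ext_gt // scaler0; apply: big1 => j _.
  rewrite xi ?linear0 ?scaler0 // => ji.
  by have:= ltn_ord j; rewrite ji ltnS leqNgt ki.
have ik1 : (i < k.+1)%N by [].
rewrite (bigD1 (Ordinal ik1)) //= big1 ?addr0 // => j ji.
rewrite xi ?linear0 ?scaler0 // => eji.
by case/eqP: ji; apply: val_inj.
Qed.

(** On a homogeneous element the convolution has a single term; the module axioms
are checked in this form and then extended by additivity. *)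
Lemma pm_scale_single p i k (v : M i) :
  pm_scale p (@single pm_zcomp i v) k = p`_(k - i) *: pm_ext k v.
Proof.
rewrite -[v in RHS](@single_in pm_zcomp).
by apply: (@pm_sum_single p i k (@single pm_zcomp i v)) => j; exact: single_out.
Qed.

Lemma pm_scale1 : left_id 1 pm_scale.
Proof.
apply: dirsum_ind => [|x y IHx IHy|i v].
- by rewrite pm_scaler0.
- by rewrite pm_scaleDr IHx IHy.
apply: dirsumP => k; rewrite pm_scale_single coef1 subn_eq0.
have [ki|ik|->] := ltngtP k i.
- by rewrite pm_ext_gt // scaler0 single_out //; apply/eqP; rewrite neq_ltn ki.
- by rewrite scale0r single_out //; apply/eqP; rewrite neq_ltn ik orbT.
- by rewrite scale1r single_in pm_extE pm_map_id.
Qed.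

Lemma pm_ext_comp i j k (v : M i) : (i <= j <= k)%N ->
  pm_ext k (pm_ext j v) = pm_ext k v.
Proof.
case/andP=> ij jk; rewrite (pm_extE ij) (pm_extE jk) (pm_extE (leq_trans ij jk)).
by rewrite (pm_map_comp ij jk).
Qed.

(** On a homogeneous element of degree i, the degree k part of both sides is
a multiple of the image of that element in degree k, and the coefficients agree
by the product formula for polynomials, after dropping the vanishing
intermediate degrees below i and shifting the index by i. *)
Lemma pm_scaleA p q (x : dirsum pm_zcomp) :
  pm_scale p (pm_scale q x) = pm_scale (p * q) x.
Proof.
elim/dirsum_ind: x => [|x y IHx IHy|i v].
- by rewrite !pm_scaler0.
- by rewrite !pm_scaleDr IHx IHy.
apply: dirsumP => k; rewrite pm_scale_single.
rewrite -[LHS]/(\sum_(j < k.+1) p`_(k - j) *: pm_ext k _).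
under eq_bigr => j _ do rewrite pm_scale_single linearZ /= scalerA.
have [ik|ki] := leqP i k; last first.
  rewrite (pm_ext_gt _ ki) scaler0; apply: big1 => j _.
  by rewrite [pm_ext j v]pm_ext_gt ?linear0 ?scaler0 // (leq_trans _ ki).
rewrite -(big_mkord xpredT
  (fun j => (p`_(k - j) * q`_(j - i)) *: pm_ext k (pm_ext j v))).
rewrite (big_cat_nat (leq0n i)) ?(leq_trans ik) //= big_nat big1 ?add0r; last first.
  by move=> j ji; rewrite [pm_ext j v]pm_ext_gt // linear0 scaler0.
rewrite coefMr scaler_suml -{1}(add0n i) big_addn subSn // big_mkord.
apply: eq_bigr => j _; rewrite addnK pm_ext_comp; last first.
  by rewrite leq_addl /= addnC -leq_subRL // -ltnS.
by rewrite addnC subnDA.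
Qed.

Lemma pm_graded i j p (x : dirsum pm_zcomp) :
  poly_summand i p -> in_summand j x -> in_summand (i + j) (pm_scale p x).
Proof.
case=> a -> /in_summandE -> k kij; rewrite pm_scale_single coefZ coefXn.
have [kj|jk] := ltnP k j; first by rewrite pm_ext_gt // scaler0.
case: eqP => [kij'|]; last by rewrite mulr0 scale0r.
by case: kij; rewrite -kij' subnK.
Qed.

Definition gmodule_of_dapm : gmodule R :=
  @GModule R pm_zcomp pm_scale pm_scaleA pm_scale1 pm_scaleDr pm_scaleDl
    pm_graded.

End GradedOfPersistence.

Section GradedOfPersistenceHom.
Variables (R : comNzRingType) (M N : dapm R) (f : dapm_hom M N).

Definition ph_sum (x : gm_sum (gmodule_of_dapm M)) :
  gm_sum (gmodule_of_dapm N).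
Proof.
exists (fun i => f i (x i)).
have [n xn] := coord_fin x; exists n => i ni.
by rewrite xn // linear0.
Defined.

Lemma ph_sum_is_linear : linear ph_sum.
Proof.
move=> p x y; apply: dirsumP => k.
rewrite -[LHS]/(f k ((p *: x : gm_sum (gmodule_of_dapm M)) k + y k : M k)).
rewrite -[RHS]/(pm_scale p (ph_sum x) k + f k (y k) : N k).
rewrite linearD; congr (_ + _).
rewrite -[LHS]/(f k (\sum_(i < k.+1) p`_(k - i) *: pm_ext k (x i) : M k)).
rewrite linear_sum; apply: eq_bigr => i _.
by rewrite linearZ !(pm_extE (leq_ord i)) ph_comm.
Qed.

HB.instance Definition _ :=
  GRing.isLinear.Build {poly R} (gm_sum (gmodule_of_dapm M))
    (gm_sum (gmodule_of_dapm N)) *:%R ph_sum ph_sum_is_linear.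

Lemma ph_sum_graded i (x : gm_sum (gmodule_of_dapm M)) :
  in_summand i x -> in_summand i (ph_sum x).
Proof. by move=> xi j ji; rewrite /= -[LHS]/(f j (x j)) xi // linear0. Qed.

Definition ghom_of_dapm_hom : ghom (gmodule_of_dapm M) (gmodule_of_dapm N) :=
  @GHom R _ _ (ph_sum : {linear _ -> _}) ph_sum_graded.

End GradedOfPersistenceHom.

Definition gmodule_functor (R : comNzRingType) :
  functor (dapm_category R) (gmodule_category R).
Proof.
refine (@Functor (dapm_category R) (gmodule_category R)
  (@gmodule_of_dapm R) (@ghom_of_dapm_hom R) _ _).
- by move=> M; apply: ghomP => x; apply: dirsumP.
- by move=> M N P g f; apply: ghomP => x; apply: dirsumP.
Defined.

(** * Equality of graded modules and of persistence modules *)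

Definition transport (S : Type) (sort : S -> Type) (U V : S) (e : U = V)
  (x : sort U) : sort V := ecast W (sort W) e x.

(** When the two carriers are already the same type, [e'] can be [erefl], and so
moving an element along an equality of structures does nothing. *)
Lemma transport_sort (S : Type) (sort : S -> Type) (U V : S) (e : U = V)
  (e' : sort U = sort V) (x : sort U) : transport e x = ecast T T e' x.
Proof. by case: V / e e' => e'; rewrite (Prop_irrelevance e' erefl). Qed.

Local Notation zcast := (@transport zmodType GRing.Zmodule.sort _ _).
Local Notation lcast := (@transport (lmodType _) (@GRing.Lmodule.sort _) _ _).

Section EqualityOfObjects.
Variable R : comNzRingType.

(** The action condition relates [x] and [y] through coordinates, so that no cast of
a whole direct sum has to be formed. *)
Lemma gmodule_eq (M N : gmodule R) (e : forall i, gm_comp M i = gm_comp N i) :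
  (forall p (x : dirsum (gm_comp M)) (y : dirsum (gm_comp N)),
     (forall i, y i = zcast (e i) (x i)) ->
     forall i, gm_scale p y i = zcast (e i) (gm_scale p x i)) ->
  M = N.
Proof.
case: M N e => [V s sA s1 sDr sDl sG] [W t tA t1 tDr tDl tG] /= e.
have VW : V = W by apply: funext.
case: W / VW t tA t1 tDr tDl tG e => t tA t1 tDr tDl tG e st.
have {st} es : s = t.
  apply: functional_extensionality_dep => p; apply: funext => x.
  apply: dirsumP => i; rewrite (st p x x) => [|j];
    by rewrite (Prop_irrelevance (e _) erefl).
case: t / es tA t1 tDr tDl tG => *.
by congr GModule; exact: Prop_irrelevance.
Qed.

Lemma eq_hom_gmodule (M N : gmodule R) (e : M = N)
    (e' : forall i, gm_comp M i = gm_comp N i) (x : gm_sum M) i :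
  (@eq_hom (gmodule_category R) M N e : ghom M N) x i = zcast (e' i) (x i).
Proof. by case: N / e e' => e'; rewrite (Prop_irrelevance (e' i) erefl). Qed.

(** This is what becomes of an additive group once it has been given a module
structure and that structure has been forgotten. It is not convertible to the
original when that one is a variable, since structure records lack definitional
eta. *)
Definition zmod_repack (V : zmodType) : zmodType :=
  GRing.Zmodule.Pack (GRing.Zmodule.class V).

Lemma zmod_repackE V : zmod_repack V = V.
Proof. by case: V. Qed.

Lemma dapm_eq (M N : dapm R) (e : forall i, M i = N i) :
  (forall i j (ij : (i <= j)%N) x,
     pm_map N ij (lcast (e i) x) = lcast (e j) (pm_map M ij x)) ->
  M = N.
Proof.
case: M N e => [V f f1 fc] [W g g1 gc] /= e.
have VW : V = W by apply: funext.
case: W / VW g g1 gc e => g g1 gc e fg.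
have {fg} fg : f = g.
  apply: functional_extensionality_dep => i.
  apply: functional_extensionality_dep => j.
  apply: functional_extensionality_dep => ij; apply: linear_ext => x.
  have:= fg i j ij x.
  by rewrite (Prop_irrelevance (e i) erefl) (Prop_irrelevance (e j) erefl).
case: g / fg g1 gc => *.
by congr DAPM; exact: Prop_irrelevance.
Qed.

Lemma eq_hom_dapm (M N : dapm R) (e : M = N) (e' : forall i, M i = N i) i x :
  (@eq_hom (dapm_category R) M N e : dapm_hom M N) i x = lcast (e' i) x.
Proof. by case: N / e e' => e'; rewrite (Prop_irrelevance (e' i) erefl). Qed.

Section Rescaling.
Variable L : lmodType R.
Let c := GRing.Lmodule.class L.

(** Spelling out the parameters of the mixin makes it possible to compare two scalar
actions on one and the same additive group. *)
Definition lmod_scaling : Type :=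
  @GRing.Nmodule_isLSemiModule.axioms_ R L
    (GRing.Lmodule.Algebra_hasZero_mixin c)
    (GRing.Lmodule.Algebra_hasAdd_mixin c)
    (GRing.Lmodule.Algebra_BaseAddUMagma_isAddUMagma_mixin c)
    (GRing.Lmodule.Algebra_BaseAddMagma_isAddMagma_mixin c)
    (GRing.Lmodule.choice_hasChoice_mixin c)
    (GRing.Lmodule.eqtype_hasDecEq_mixin c)
    (GRing.Lmodule.Algebra_AddMagma_isAddSemigroup_mixin c).

Definition lmod_rescale (m : lmod_scaling) : lmodType R :=
  GRing.Lmodule.Pack (GRing.Lmodule.Class
    (GRing.Lmodule.Algebra_BaseZmoduleNmodule_isZmodule_mixin c) m).
End Rescaling.

(** Proof irrelevance of the module axioms leaves only the scalar multiplication to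
be compared. *)
Lemma lmod_rescaleE (L : lmodType R) (m : lmod_scaling L) :
  (forall a v, GRing.Nmodule_isLSemiModule.scale m a v = a *: v) ->
  lmod_rescale m = L.
Proof.
pose m' : lmod_scaling L :=
  GRing.Lmodule.GRing_Nmodule_isLSemiModule_mixin (GRing.Lmodule.class L).
move=> mm'; have {mm'} -> : m = m'.
  have {mm'} : forall a v, GRing.Nmodule_isLSemiModule.scale m a v =
    GRing.Nmodule_isLSemiModule.scale m' a v by [].
  case: m m' => [s sA s0 s1 sDr sDl] [t tA t0 t1 tDr tDl] /= st.
  have {}st : s = t by do 2![apply: functional_extensionality_dep => ?].
  case: t / st tA t0 t1 tDr tDl => *.
  by congr GRing.Nmodule_isLSemiModule.Axioms_; exact: Prop_irrelevance.
by rewrite {}/m'; case: L m.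
Qed.

End EqualityOfObjects.

(** * The strict isomorphism on all objects *)

Section RoundTrips.
Variable R : comNzRingType.

(** The R[t]-action of a graded module is recovered from its components and its
shifts by the same convolution that defines [pm_scale]. *)
Lemma coord_gm_scale (M : gmodule R) (p : {poly R}) (y : gm_sum M) k :
  (p *: y) k =
  \sum_(i < k.+1) p`_(k - i) *: @pm_ext R (dapm_of_gmodule M) i k (y i).
Proof.
elim/dirsum_ind: y => [|x y IHx IHy|i v].
- rewrite scaler0; symmetry; apply: big1 => i _.
  by rewrite [X in _ *: X]linear0 scaler0.
- rewrite scalerDr -[LHS]/((p *: (x : gm_sum M)) k +
    (p *: (y : gm_sum M)) k : gm_lcomp M k) {}IHx {}IHy.
  rewrite -big_split; apply: eq_bigr => i _ /=.
  by rewrite -[(x + y) i]/((x i : gm_lcomp M i) + y i) linearD scalerDr.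
rewrite (@pm_sum_single R (dapm_of_gmodule M) p i k (@single (gm_comp M) i v)).
  rewrite single_in; have [ik|ki] := leqP i k.
    rewrite pm_extE coord_scale // -[RHS]/(gm_lscale _ (gm_shift ik _)).
    by rewrite /gm_lscale single_shift scalerA mul_polyC.
  rewrite pm_ext_gt // scaler0 coord_scale_eq0 // => j jik.
  by move: ki; rewrite -jik ltnNge leq_addl.
by move=> j; exact: (@single_out (gm_comp M)).
Qed.

(** The other homogeneous parts of [x] are sent to other degrees. *)
Lemma coord_ghom (M N : gmodule R) (f : ghom M N) (x : gm_sum M) k :
  f x k = f (gsingle M (x k)) k.
Proof.
elim/dirsum_ind: x => [|x y IHx IHy|i v].
- by rewrite -[in RHS]/(0 : gm_comp M k) single0 !linear0.
- rewrite linearD -[LHS]/(f x k + f y k) IHx IHy -[(x + y) k]/(x k + y k).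
  by rewrite singleD linearD.
have [->|/eqP ki] := eqVneq k i; first by rewrite single_in.
rewrite (gh_graded f (in_summand_single v)) // single_out //.
by rewrite single0 linear0.
Qed.

Lemma gmodule_of_dapmK (M : gmodule R) : gmodule_of_dapm (dapm_of_gmodule M) = M.
Proof.
have e i : gm_comp (gmodule_of_dapm (dapm_of_gmodule M)) i = gm_comp M i.
  exact: (zmod_repackE (gm_comp M i)).
have castE i (v : gm_comp M i) : zcast (e i) v = v :=
  @transport_sort _ GRing.Zmodule.sort _ _ (e i) erefl v.
apply: (gmodule_eq (e := e)) => p x y xy k; rewrite castE.
have {}xy i : y i = x i by rewrite xy castE.
rewrite -[LHS]/((p *: (y : gm_sum M)) k) coord_gm_scale.
rewrite -[RHS]/(\sum_(i < k.+1)
  p`_(k - i) *: @pm_ext R (dapm_of_gmodule M) i k (x i)).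
by apply: eq_bigr => i _; rewrite xy.
Qed.

Lemma gm_lscale_dapm (N : dapm R) i a (v : N i) :
  gm_lscale (M := gmodule_of_dapm N) a v = a *: v.
Proof.
rewrite -[LHS]/(pm_scale a%:P (@single (pm_zcomp N) i v) i) pm_scale_single.
by rewrite subnn coefC pm_extE pm_map_id.
Qed.

Lemma gm_shift_dapm (N : dapm R) i j (ij : (i <= j)%N) (v : N i) :
  gm_shift (M := gmodule_of_dapm N) ij v = pm_map N ij v.
Proof.
rewrite -[LHS]/(pm_scale 'X^(j - i) (@single (pm_zcomp N) i v) j).
by rewrite pm_scale_single coefXn eqxx scale1r pm_extE.
Qed.

Lemma dapm_of_gmoduleK (N : dapm R) : dapm_of_gmodule (gmodule_of_dapm N) = N.
Proof.
have e i : dapm_of_gmodule (gmodule_of_dapm N) i = N i.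
  apply: (@lmod_rescaleE R (N i) (GRing.Lmodule.GRing_Nmodule_isLSemiModule_mixin
    (GRing.Lmodule.class (dapm_of_gmodule (gmodule_of_dapm N) i)))).
  exact: gm_lscale_dapm.
have castE i (v : N i) : lcast (e i) v = v :=
  @transport_sort _ (@GRing.Lmodule.sort R) _ _ (e i) erefl v.
by apply: (dapm_eq (e := e)) => i j ij x; rewrite !castE -gm_shift_dapm.
Qed.

Lemma gmodule_functorK :
  comp_functor (gmodule_functor R) (dapm_functor R) = id_functor _.
Proof.
apply: (@functor_eq _ _ (comp_functor (gmodule_functor R) (dapm_functor R))
  (id_functor _) gmodule_of_dapmK) => M N f.
apply: ghomP => x; apply: dirsumP => k.
pose e (P : gmodule R) i :
    gm_comp (gmodule_of_dapm (dapm_of_gmodule P)) i = gm_comp P i :=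
  zmod_repackE (gm_comp P i).
have castE (P : gmodule R) i (v : gm_comp P i) : zcast (e P i) v = v :=
  @transport_sort _ GRing.Zmodule.sort _ _ (e P i) erefl v.
rewrite /= (eq_hom_gmodule _ (e N)) castE.
rewrite [RHS]coord_ghom (eq_hom_gmodule _ (e M)) castE.
by [].
Qed.

Lemma dapm_functorK :
  comp_functor (dapm_functor R) (gmodule_functor R) = id_functor _.
Proof.
apply: (@functor_eq _ _ (comp_functor (dapm_functor R) (gmodule_functor R))
  (id_functor _) dapm_of_gmoduleK) => M N f.
apply: dapm_homP => i v.
have e (P : dapm R) j : dapm_of_gmodule (gmodule_of_dapm P) j = P j.
  by rewrite dapm_of_gmoduleK.
have castE (P : dapm R) j (w : P j) : lcast (e P j) w = w :=
  @transport_sort _ (@GRing.Lmodule.sort R) _ _ (e P j) erefl w.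
rewrite /= !(eq_hom_dapm _ (e _)) !castE.
by rewrite /gh_comp -[LHS]/(f i (@single (pm_zcomp M) i v i)) single_in.
Qed.

End RoundTrips.

(** * Submodules of finitely generated modules over Noetherian rings *)

Section Spans.
Variables (R : pzRingType) (L : lmodType R).
Implicit Types (s t : seq L) (N : L -> Prop).

Definition is_submodule N : Prop :=
  [/\ N 0, forall x y, N x -> N y -> N (x + y) & forall a x, N x -> N (a *: x)].

Lemma submodule_sum N (I : Type) (r : seq I) (P : pred I) (F : I -> L) :
  is_submodule N -> (forall i, P i -> N (F i)) -> N (\sum_(i <- r | P i) F i).
Proof. by case=> N0 ND _ NF; apply: big_ind. Qed.

Definition in_span s (x : L) : Prop :=
  exists a : nat -> R, x = \sum_(i < size s) a i *: s`_i.

Lemma span_submodule s : is_submodule (in_span s).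
Proof.
split=> [|x y [a ->] [b ->]|c x [a ->]].
- by exists (fun=> 0); rewrite big1 // => i _; rewrite scale0r.
- exists (fun i => a i + b i); rewrite -big_split.
  by apply: eq_bigr => i _; rewrite scalerDl.
- exists (fun i => c * a i); rewrite scaler_sumr.
  by apply: eq_bigr => i _; rewrite scalerA.
Qed.

Lemma mem_span s x : x \in s -> in_span s x.
Proof.
move=> xs; exists (fun i => (i == index x s)%:R).
have ix : (index x s < size s)%N by rewrite index_mem.
rewrite (bigD1 (Ordinal ix)) //= eqxx scale1r nth_index // big1 ?addr0 //.
by move=> i /negPf ii; rewrite -val_eqE /= in ii; rewrite ii scale0r.
Qed.

Lemma span_min s N x :
  is_submodule N -> {in s, forall y, N y} -> in_span s x -> N x.
Proof.
move=> subN sN [a ->]; apply: submodule_sum => // i _.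
by case: subN => _ _; apply; apply/sN/mem_nth.
Qed.

Lemma span_sub s t x : {subset s <= t} -> in_span s x -> in_span t x.
Proof.
by move=> st; apply: span_min (span_submodule t) _ => y /st; exact: mem_span.
Qed.

Lemma span_cons y s x : in_span (y :: s) x ->
  exists a z, in_span s z /\ x = a *: y + z.
Proof.
case=> a ->; exists (a 0%N), (\sum_(i < size s) a i.+1 *: s`_i).
by split; [exists (fun i => a i.+1) | rewrite big_ord_recl].
Qed.

Lemma submoduleB N x y : is_submodule N -> N x -> N y -> N (x - y).
Proof. by case=> _ ND NZ Nx Ny; apply: ND; rewrite // -scaleN1r; exact: NZ. Qed.

End Spans.

(** Induction on the number of generators y :: s of the ambient span. The leading
coefficients a of the elements a y + z of N, with z in the span of s, form an
ideal; finitely many elements of N realise generators of it. Subtracting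
a combination of these from an element of N removes its y-part, which leaves an
element of N in the span of s. *)
Lemma noetherian_submodule (R : comNzRingType) (L : lmodType R) (s : seq L)
    (N : L -> Prop) :
  noetherian R -> is_submodule N -> (forall x, N x -> in_span s x) ->
  exists t : seq L, {in t, forall x, N x} /\ forall x, N x -> in_span t x.
Proof.
move=> noethR; elim: s N => [|y s IHs] N subN Ns; first by exists [::].
have [N0 ND NZ] := subN; have [S0 SD SZ] := span_submodule s.
pose I a := exists z, in_span s z /\ N (a *: y + z).
have idealI : is_ideal I.
  split=> [|a b [z [sz Nz]] [w [sw Nw]]|a b [z [sz Nz]]].
  - by exists 0; rewrite scale0r addr0.
  - exists (z + w); split; first exact: SD.
    by rewrite scalerDl addrACA; exact: ND.
  - exists (a *: z); split; first exact: SZ.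
    by rewrite -scalerA -scalerDr; exact: NZ.
have [r rI] := noethR I idealI.
(* Lifts to N of the generators r of the ideal of leading coefficients. *)
have [t [tN tr]] : exists t : seq L, {in t, forall x, N x} /\
    {in r, forall a, exists z, in_span s z /\ in_span t (a *: y + z)}.
  have: {in r, forall a, I a}.
    by move=> a ar; apply/rI; exact: (@mem_span R R^o).
  elim: r {rI} => [|a r IHr] ri; first by exists [::].
  have [|t [tN tr]] := IHr; first by move=> b br; apply: ri; rewrite inE br orbT.
  have [z [sz Nz]] := ri a (mem_head a r).
  exists (a *: y + z :: t); split=> [x|b].
    by rewrite inE => /orP[/eqP->|/tN].
  rewrite inE => /orP[/eqP->|/tr[w [sw tw]]].
    by exists z; split=> //; apply: mem_span; rewrite mem_head.
  exists w; split=> //; apply: span_sub tw => x xt.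
  by rewrite inE xt orbT.
(* Generators of the part of N without y, from the induction hypothesis. *)
have [|x []//|t' [t'N Nt']] := IHs (fun x => N x /\ in_span s x).
  split=> [|x w [Nx sx] [Nw sw]|a x [Nx sx]]; first by [].
    by split; [exact: ND | exact: SD].
  by split; [exact: NZ | exact: SZ].
exists (t ++ t'); split=> [x|x Nx].
  by rewrite mem_cat => /orP[/tN|/t'N[]].
have [a [z [sz xE]]] := span_cons (Ns x Nx).
have [T0 TD TZ] := span_submodule t.
(* The coefficients a that some element of the span of t realises form an ideal
   containing r, hence all of I. *)
have [w [sw tw]] : exists w, in_span s w /\ in_span t (a *: y + w).
  have /rI ra : I a by exists z; rewrite -xE.
  apply: (@span_min R R^o r _ a) (tr) (ra); split.
  - by exists 0; rewrite scale0r addr0.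
  - move=> b c [u [su tu]] [v [sv tv]]; exists (u + v).
    by split; [exact: SD | rewrite scalerDl addrACA; exact: TD].
  - move=> b c [u [su tu]]; exists (b *: u).
    by split; [exact: SZ | rewrite -scalerA -scalerDr; exact: TZ].
have t'x : in_span t' (x - (a *: y + w)).
  apply: Nt'; split.
    by apply: submoduleB => //; exact: span_min tN tw.
  by rewrite xE opprD addrACA subrr add0r; exact: submoduleB (span_submodule s) _ _.
rewrite -[x](subrK (a *: y + w)); have [_ + _] := span_submodule (t ++ t').
apply.
  by apply: span_sub t'x => u ut; rewrite mem_cat ut orbT.
by apply: span_sub tw => u ut; rewrite mem_cat ut.
Qed.

(** * Finite generation and finite type *)

Section FiniteGeneration.
Variable R : comNzRingType.

Lemma bijective_linear_iso (U V : lmodType R) (f : {linear U -> V}) :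
  injective f -> (forall w, exists v, w = f v) -> linear_iso f.
Proof.
move=> finj fsurj; pose g w := sval (cid (fsurj w)).
have gK : cancel g f by move=> w; rewrite /g; case: cid.
have glin : linear g by move=> a v w; apply: finj; rewrite linearP !gK.
pose gL := GRing.isLinear.Build R V U *:%R g glin.
exists (HB.pack_for {linear V -> U} g gL); split=> //= v.
by apply: finj; rewrite gK.
Qed.

(** The elements of degree D that vanish in some later degree form a submodule K. It
is finitely generated, so one degree E kills its generators and hence all of K.
An element of degree i >= E that vanishes later lifts to K, because degree
D maps onto degree i, and so it is already 0. *)
Lemma finite_type_of_surjective (N : dapm R) D :
  noetherian R -> finitely_generated (N D) ->
  (forall j (Dj : (D <= j)%N) w, exists v, w = pm_map N Dj v) -> finite_type N.
Proof.
move=> noethR [s Ns] surjN.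
pose K (v : N D) := exists j, (D <= j)%N /\ pm_ext j v = 0.
have pm_ext0 j k (v : N D) :
    (D <= j <= k)%N -> pm_ext j v = 0 -> pm_ext k v = 0.
  by move=> Djk vj; rewrite -(pm_ext_comp v Djk) vj linear0.
have subK : is_submodule K.
  split=> [|v w [j [Dj vj]] [k [Dk wk]]|a v [j [Dj vj]]].
  - by exists D; rewrite linear0.
  - exists (maxn j k); split; first by rewrite leq_max Dj.
    have vjk : pm_ext (maxn j k) v = 0 by apply: pm_ext0 vj; rewrite Dj leq_maxl.
    have wjk : pm_ext (maxn j k) w = 0 by apply: pm_ext0 wk; rewrite Dk leq_maxr.
    by rewrite linearD /= vjk wjk addr0.
  - by exists j; rewrite linearZ /= vj scaler0.
have [t [tK Kt]] := noetherian_submodule noethR subK (fun x _ => Ns x).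
have [E [DE tE]] : exists E, (D <= E)%N /\ {in t, forall v, pm_ext E v = 0}.
  elim: t tK {Kt} => [|v t IHt] tK; first by exists D.
  have [|E [DE tE]] := IHt; first by move=> w wt; apply: tK; rewrite inE wt orbT.
  have [j [Dj vj]] := tK v (mem_head v t).
  exists (maxn E j); split; first by rewrite leq_max DE.
  move=> w; rewrite inE => /orP[/eqP->|/tE wE].
    by apply: pm_ext0 vj; rewrite Dj leq_maxr.
  by apply: pm_ext0 wE; rewrite DE leq_maxl.
have KE v : K v -> pm_ext E v = 0.
  move/Kt; apply: span_min tE; split=> [|x y x0 y0|a x x0].
  - exact: linear0.
  - by rewrite linearD /= x0 y0 addr0.
  - by rewrite linearZ /= x0 scaler0.
exists E => i j ij Ei; have Di := leq_trans DE Ei; have Dj := leq_trans Di ij.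
apply: bijective_linear_iso => [v w vw|w].
  have [u uE] := surjN i Di (v - w).
  apply: subr0_eq; rewrite uE -(pm_extE Di).
  apply: (pm_ext0 E); rewrite ?DE //; apply: KE; exists j; split=> //.
  rewrite (pm_extE Dj) (pm_map_comp Di ij) -uE linearB.
  by rewrite vw subrr.
have [v ->] := surjN j Dj w; exists (pm_map N Di v).
exact: pm_map_comp.
Qed.

Section GradedToPersistence.
Variables (M : gmodule R) (s : seq (gm_sum M)).
Hypothesis Ms : forall x : gm_sum M, in_span s x.

Definition component_gens j : seq (dapm_of_gmodule M j) :=
  flatten [seq [seq @pm_ext R (dapm_of_gmodule M) i j (x i) | x : gm_sum M <- s]
          | i <- iota 0 j.+1].

(** The degree j part of a multiple of a generator x is, by [coord_gm_scale], an
R-linear combination of the shifted parts of x. *)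
Lemma component_gens_span j (v : dapm_of_gmodule M j) :
  in_span (component_gens j) v.
Proof.
have [a vE] := Ms (gsingle M v).
have -> : v = (gsingle M v) j by rewrite single_in.
rewrite vE coord_sum.
apply: (@submodule_sum R (dapm_of_gmodule M j)); first exact: span_submodule.
move=> k _; rewrite coord_gm_scale.
apply: submodule_sum => [|i _]; first exact: span_submodule.
have [_ _ SZ] := span_submodule (component_gens j); apply: SZ.
apply: mem_span; apply/flatten_mapP; exists (i : nat).
  by rewrite mem_iota /= ltn_ord.
by apply/mapP; exists s`_k => //; exact: mem_nth.
Qed.

Lemma support_bound :
  exists D, {in s, forall (x : gm_sum M) i, (D < i)%N -> x i = 0}.
Proof.
elim: s => [|x t [D tD]]; first by exists 0%N.
have [n xn] := coord_fin x; exists (maxn D n) => y.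
rewrite inE => /orP[/eqP->|yt] i; rewrite gtn_max => /andP[Di ni].
  by apply: xn; exact: ltnW.
exact: tD.
Qed.

(** Above the degree D that bounds the supports of the generators, the generators of
each component come from degree D by a shift. *)
Lemma fg_type_dapm_of_gmodule : noetherian R -> fg_type (dapm_of_gmodule M).
Proof.
move=> noethR; have fgM j : finitely_generated (dapm_of_gmodule M j).
  by exists (component_gens j); exact: component_gens_span.
split=> //; have [D sD] := support_bound.
apply: (@finite_type_of_surjective _ D) => // j Dj w.
apply: (span_min (N := fun w => exists v, w = pm_map _ Dj v) _ _
  (component_gens_span w)) => [|v].
  split=> [|x y [v ->] [w' ->]|a x [v ->]].
  - by exists 0; rewrite linear0.
  - by exists (v + w'); rewrite linearD.
  - by exists (a *: v); rewrite linearZ.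
case/flatten_mapP=> i _ /mapP[x xs ->]; have [iD|Di] := leqP i D.
  exists (pm_ext D (x i : dapm_of_gmodule M i)).
  by rewrite -pm_extE pm_ext_comp // iD.
exists 0; rewrite linear0 (sD x xs i Di).
exact: (@linear0 _ _ _ _ (@pm_ext R (dapm_of_gmodule M) i j)).
Qed.

End GradedToPersistence.

(** Only the degrees up to D need generators: if the transition maps are onto from
degree D on, an element of degree i > D is t^(i - D) times one of degree D. *)
Lemma fg_gmodule_of_dapm (N : dapm R) :
  fg_type N -> finitely_generated (gm_sum (gmodule_of_dapm N)).
Proof.
case=> -[D isoN] fgN; pose G := gmodule_of_dapm N.
pose gens i : seq (N i) := sval (cid (fgN i)).
have gensP i (v : N i) : in_span (gens i) v.
  exact: (svalP (cid (fgN i)) v).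
pose t : seq (gm_sum G) :=
  flatten [seq [seq gsingle G v | v <- gens i] | i <- iota 0 D.+1].
have [T0 TD TZ] := span_submodule t.
have low i (v : N i) : (i <= D)%N -> in_span t (gsingle G v).
  move=> iD.
  apply: (span_min (N := fun v => in_span t (gsingle G v)) _ _ (gensP i v)).
    split=> [|x y tx ty|a x tx]; first by rewrite single0.
      by rewrite singleD; exact: TD.
    by rewrite -gm_lscale_dapm single_lscale; exact: TZ.
  move=> w wi; apply: mem_span; apply/flatten_mapP.
  exists i; first by rewrite mem_iota.
  by apply/mapP; exists w.
exists t; elim/dirsum_ind => [|x y tx ty|i v]; [exact: T0 | exact: TD |].
have [/low//|/ltnW Di] := leqP i D; first exact.
have [g [_ gK]] := isoN D i Di (leqnn D).
rewrite -(gK v) -gm_shift_dapm single_shift; apply: TZ.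
exact: low.
Qed.

End FiniteGeneration.

Theorem corollary9 (R : comNzRingType) (R_noetherian : noetherian R) :
  isomorphic_categories (fg_gmodule_category R) (fg_dapm_category R).
Proof.
have PQ (M : gmodule_category R) : finitely_generated (gm_sum M) ->
    fg_type (dapm_functor R M).
  by case=> s Ms; exact: (fg_type_dapm_of_gmodule (s := s)).
have QP (N : dapm_category R) : fg_type N ->
    finitely_generated (gm_sum (gmodule_functor R N)).
  exact: fg_gmodule_of_dapm.
exists (full_restriction PQ), (full_restriction QP).
split; apply: full_restriction_cancel.
- exact: gmodule_functorK.
- exact: dapm_functorK.
Qed.
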